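(* Let $\Pi_q$ be an arbitrary finite projective plane of order $q\ge 2$ (not necessarily Desarguesian). Then the minimum size of a saturating set $S$ in $\Pi_q$ satisfies $$\min |S| \le \left\lceil\sqrt{3q\ln q}\right\rceil+\left\lceil\frac{\sqrt{q}+1}{2}\right\rceil .$$
   Context: A projective plane of order $q$ has $q^2+q+1$ points and $q^2+q+1$ lines, with $q+1$ points on every line and $q+1$ lines through every point. A set $S$ of points of $\Pi_q$ is called saturating if every point of $\Pi_q$ outside $S$ is collinear with two distinct points of $S$ (i.e. lies on a line containing two distinct points of $S$). *)

(* Defs.v *)
From HB Require Import structures.
From mathcomp Require Import all_boot.

Set Implicit Arguments.
Unset Strict Implicit.
Unset Printing Implicit Defensive.

(* A finite projective plane of order q, given by its incidence relation [inc]
   between a finite type of points P and a finite type of lines L.  The counts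
   q^2+q+1 (points, lines) and q+1 (lines through a point) are consequences of
   these axioms and are therefore not assumed. *)
Record projective_plane (P L : finType) (inc : P -> L -> bool) (q : nat) : Prop :=
  ProjectivePlane {
    pp_join : forall x y : P, x != y -> exists! l : L, inc x l && inc y l;
    pp_meet : forall l m : L, l != m -> exists! x : P, inc x l && inc x m;
    (* there are four points, no three of them on a line *)
    pp_quadrangle : exists2 A : {set P}, #|A| = 4 &
                      forall l : L, #|[set x in A | inc x l]| <= 2;
    pp_order : forall l : L, #|[set x | inc x l]| = q.+1
  }.

Definition saturating (P L : finType) (inc : P -> L -> bool) (S : {set P}) : bool :=
  [forall x, (x \notin S) ==>
    [exists l, [exists y in S, [exists z in S,
      [&& y != z, inc x l, inc y l & inc z l]]]]].

(* The set of all points is saturating (see [saturating_setT]), so the minimum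
   ranges over a nonempty family. *)
Definition min_saturating (P L : finType) (inc : P -> L -> bool) : nat :=
  #|[arg min_(S < [set: P] | saturating inc S) #|S|]|.

Lemma saturating_setT (P L : finType) (inc : P -> L -> bool) :
  saturating inc [set: P].
Proof. by apply/forallP => x; rewrite in_setT. Qed.

Lemma min_saturatingP (P L : finType) (inc : P -> L -> bool) :
  (exists2 S, saturating inc S & #|S| = min_saturating inc) /\
  (forall S, saturating inc S -> min_saturating inc <= #|S|).
Proof.
rewrite /min_saturating; case: arg_minnP => [|S satS minS].
  exact: saturating_setT.
by split; [exists S | exact: minS].
Qed.

(* Main.v *)
Require Import Defs.
From Stdlib Require Import BinNat Nnat.
From mathcomp Require Import all_boot all_order all_algebra.
From mathcomp Require Import reals topology normedtype sequences derive exp.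
From mathcomp Require Import ring lra zify.

Import Order.TTheory GRing.Theory Num.Theory.
Import numFieldNormedType.Exports.

Set Implicit Arguments.
Unset Strict Implicit.

(** Write N = q^2 + q + 1.  Build S greedily: if |S| = k and u points are
    unsaturated, the k lines joining an unsaturated x to S are distinct and each
    carries q - 1 points besides x and its point of S; adding any of these points,
    or x itself, saturates x.  By averaging, some point outside S leaves at most
    u (1 - (k (q - 1) + 1) / (N - k)) <= u (1 - k / (q + 2)) points unsaturated.
    With k = ceil (sqrt (3 q ln q)) points, at most sqrt q + 1 unsaturated points
    remain, and they can be saturated two at a time by one further point each.

    The estimate is tight up to lower-order terms, so the second-order bound
    1 - y <= exp (- y - y^2 / 2) is needed.  It suffices for q >= 64; for smaller
    q the recursion, rounded down at each step, is evaluated. *)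

(** * Saturation in a projective plane *)

Section Plane.
Variables (P L : finType) (inc : P -> L -> bool) (q : nat).
Hypothesis plane : projective_plane inc q.

(** * Incidence and counting points *)

Definition collinear3 (x y z : P) : bool :=
  [exists l, [&& inc x l, inc y l & inc z l]].

Lemma exists_line x y : x != y -> exists2 l, inc x l & inc y l.
Proof. by move=> /(pp_join plane)[l [/andP[xl yl] _]]; exists l. Qed.

Lemma line_unique x y l m :
  x != y -> inc x l -> inc y l -> inc x m -> inc y m -> l = m.
Proof.
move=> /(pp_join plane)[n [_ nP]] xl yl xm ym.
by rewrite -(nP l) ?xl// -(nP m) ?xm.
Qed.

Lemma collinear3E x y z l :
  x != y -> inc x l -> inc y l -> collinear3 x y z = inc z l.
Proof.
move=> xy xl yl; apply/existsP/idP => [[m /and3P[xm ym zm]]|zl].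
  by rewrite (line_unique xy xl yl xm ym).
by exists l; rewrite xl yl.
Qed.

Lemma card_line_rest x y : x != y ->
  #|[set z | (z != x) && collinear3 x y z]| = q.
Proof.
move=> xy; have [l xl yl] := exists_line xy.
have /eqP := pp_order plane l.
rewrite (cardsD1 x) inE xl add1n eqSS => /eqP <-.
by apply: eq_card => z; rewrite !inE (collinear3E _ _ xl yl).
Qed.

Lemma card_line_rest2 x y : x != y ->
  #|[set z | [&& z != x, z != y & collinear3 x y z]]| = q.-1.
Proof.
move=> xy; have := card_line_rest xy.
rewrite (cardsD1 y) !inE eq_sym xy.
have [l xl yl] := exists_line xy.
rewrite (collinear3E _ xy xl yl) yl add1n => <- /=.
by apply: eq_card => z; rewrite !inE andbCA.
Qed.

Lemma point_off_line : exists p l, ~~ inc p l.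
Proof.
have [A cA Al] := pp_quadrangle plane.
have /card_gt1P[x [y [xA yA xy]]] : 1 < #|A| by rewrite cA.
have [l xl yl] := exists_line xy.
have : ~~ (A \subset [set z in A | inc z l]).
  by apply/negP => /subset_leq_card; rewrite cA leqNgt (leq_ltn_trans (Al l)).
by case/subsetPn => p pA; rewrite inE pA => pl; exists p, l.
Qed.

(** Project from a point [p] off a line [l]: the q + 1 lines joining [p] to the points of [l] carry
    q points each besides [p]. They cover the plane because every line through [p] meets [l]. *)
Lemma card_points_le : #|P| <= (q ^ 2 + q).+1.
Proof.
have [p [l pl]] := point_off_line.
rewrite (cardD1 p) add1n ltnS.
have -> : q ^ 2 + q = \sum_(z in [set z | inc z l])
    \sum_(y in [set y | (y != p) && collinear3 p z y]) 1.
  rewrite (eq_bigr (fun=> q)) => [|z].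
    by rewrite sum_nat_const (pp_order plane) mulSn -mulnn addnC.
  rewrite inE sum1_card => zl; apply: card_line_rest.
  by apply: contraNneq pl => ->.
rewrite (exchange_big_dep (predD1 predT p)) /=; last by move=> z y; rewrite !inE => _ /andP[->].
rewrite -sum1_card; apply: leq_sum => y /andP[yp _].
have [m ym pm] := exists_line yp.
have lm : l != m by apply: contraNneq pl => ->.
have [z [/andP[zl zm] _]] := pp_meet plane lm.
rewrite sum1_card; apply/card_gt0P; exists z.
rewrite unfold_in /= !inE zl yp /=.
by apply/existsP; exists m; rewrite pm zm ym.
Qed.

(** * Unsaturated points *)

Definition unsaturated (S : {set P}) : {set P} :=
  [set x | (x \notin S) &&
    [forall y in S, forall z in S, (y != z) ==> ~~ collinear3 x y z]].

Lemma saturatingE (S : {set P}) : saturating inc S = (unsaturated S == set0).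
Proof.
apply/forallP/eqP => [sat|un0 x].
  apply/setP => x; rewrite !inE; apply/negP => /andP[xS /forall_inP un].
  have /existsP[l /exists_inP[y yS /exists_inP[z zS /and4P[yz xl yl zl]]]] :=
    implyP (sat x) xS.
  have /forall_inP/(_ z zS) := un y yS; rewrite yz => /existsP; apply.
  by exists l; rewrite xl yl.
apply/implyP => xS; have := in_set0 x; rewrite -un0 inE xS /=.
move=> /negbT; rewrite negb_forall_in => /exists_inP[y yS].
rewrite negb_forall_in => /exists_inP[z zS].
rewrite negb_imply negbK => /andP[yz /existsP[l /and3P[xl yl zl]]].
apply/existsP; exists l; apply/exists_inP; exists y => //.
by apply/exists_inP; exists z; rewrite ?yz ?xl ?yl.
Qed.

Lemma unsaturatedP (S : {set P}) x : reflect
  (x \notin S /\ forall y z, y \in S -> z \in S -> y != z -> ~~ collinear3 x y z)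
  (x \in unsaturated S).
Proof.
rewrite inE; apply: (iffP andP) => -[xS un]; split => //.
  by move=> y z yS zS; apply/implyP; move/forall_inP: un => /(_ y yS)/forall_inP/(_ z zS).
by apply/forall_inP => y yS; apply/forall_inP => z zS; apply/implyP/un.
Qed.

Lemma unsaturatedS (S T : {set P}) :
  S \subset T -> unsaturated T \subset unsaturated S.
Proof.
move=> /subsetP ST; apply/subsetP => x /unsaturatedP[xT un].
by apply/unsaturatedP; split=> [|y z /ST yT /ST]; [apply: contra xT => /ST | apply: un].
Qed.

Lemma collinear3_rot x y z : collinear3 x y z = collinear3 z x y.
Proof. by apply: eq_existsb => l; rewrite andbA andbC. Qed.

Lemma collinear3_swap x y z : collinear3 x y z = collinear3 x z y.
Proof. by apply: eq_existsb => l; rewrite [inc y l && _]andbC. Qed.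

Lemma collinear3_trans x p y z : x != p ->
  collinear3 x p y -> collinear3 x p z -> collinear3 x y z.
Proof.
move=> xp; have [l xl pl] := exists_line xp.
rewrite !(collinear3E _ xp xl pl) => yl zl.
by apply/existsP; exists l; rewrite xl yl.
Qed.

Lemma saturated_setU1 (S : {set P}) x s p : s \in S -> p != s -> collinear3 x s p ->
  x \notin unsaturated (p |: S).
Proof.
move=> sS ps xsp; apply/negP => /unsaturatedP[_ /(_ s p)].
by rewrite !inE sS eqxx orbT eq_sym ps xsp => /(_ isT isT isT).
Qed.

(* Distinct s in S give distinct lines through the unsaturated point x, each
   carrying q - 1 further points, none of them in S. *)
Lemma card_saturating_points (S : {set P}) x : x \in unsaturated S ->
  #|S| * q.-1 + 1 <= #|[set p | (p \notin S) && (x \notin unsaturated (p |: S))]|.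
Proof.
move=> xU; have /unsaturatedP[xS un] := xU.
(* The choice [p = x] accounts for the [+ 1]. *)
rewrite [X in _ <= X](cardsD1 x) inE xS /= addn1.
have -> /= : x \notin unsaturated (x |: S).
  by apply/negP => /unsaturatedP[]; rewrite setU11.
rewrite add1n ltnS.
have nxs s : s \in S -> x != s by move=> sS; apply: contraNneq xS => ->.
have -> : #|S| * q.-1 = \sum_(s in S)
    \sum_(p in [set p | [&& p != x, p != s & collinear3 x s p]]) 1.
  rewrite (eq_bigr (fun=> q.-1)) ?sum_nat_const// => s sS.
  by rewrite sum1_card card_line_rest2 ?nxs.
rewrite (exchange_big_dep (mem ([set p | (p \notin S) &&
    (x \notin unsaturated (p |: S))] :\ x))) /= => [|s p sS].
  (* No [p] is counted twice: lying on both lines [xs] and [xt], it would make [x], [s], [t]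
     collinear. *)
  rewrite -sum1_card; apply: leq_sum => p _.
  rewrite sum1_card; apply/card_le1_eqP => s t.
  move=> /andP[sS +] /andP[tS +].
  rewrite !inE => /and3P[px _ xsp] /and3P[_ _ xtp].
  apply/eqP; rewrite eq_sym; apply: contraT => st.
  have := un s t sS tS; rewrite st => /(_ isT)/negP; case.
  by apply: (@collinear3_trans x p); rewrite 1?eq_sym// collinear3_swap.
rewrite inE => /and3P[px ps xsp]; apply/setD1P; split=> //.
rewrite in_set (saturated_setU1 sS ps xsp) andbT.
by apply/negP => pS; have := un s p sS pS; rewrite eq_sym ps xsp => /(_ isT).
Qed.

(** * The greedy construction and its completion *)

Local Notation npoints := (q ^ 2 + q).+1.

(** Double count the pairs of an unsaturated [x] and a point [r] outside [S] whose addition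
    saturates [x]. A point of maximal gain does at least as well as the average. Denominators are
    cleared to stay in the naturals. *)
Lemma greedy_step (S : {set P}) : unsaturated S != set0 -> exists2 p, p \notin S &
  (npoints - #|S|) * #|unsaturated (p |: S)| + (#|S| * q.-1 + 1) * #|unsaturated S|
    <= (npoints - #|S|) * #|unsaturated S|.
Proof.
case/set0Pn => x0 x0U; have /unsaturatedP[x0S _] := x0U.
set U := unsaturated S; set a := _ + 1.
pose gain p := #|U :\: unsaturated (p |: S)|.
have [p pS pmax] := arg_maxnP gain (x0S : [pred p | p \notin S] x0).
exists p => //.
have sub : unsaturated (p |: S) \subset U by apply/unsaturatedS/subsetUr.
have gainE : gain p + #|unsaturated (p |: S)| = #|U|.
  by rewrite -(cardsID (unsaturated (p |: S)) U) (setIidPr sub) addnC.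
suff : a * #|U| <= (npoints - #|S|) * gain p.
  by move=> ?; rewrite -[X in _ <= _ * X]gainE mulnDr [X in _ <= X]addnC leq_add2l.
apply: (@leq_trans (#|~: S| * gain p)); last first.
  by rewrite leq_mul2r cardsCs setCK leq_sub2r ?orbT// card_points_le.
have -> : #|~: S| = #|[pred p | p \notin S]| by apply: eq_card => y; rewrite !inE.
rewrite -sum_nat_const; apply: (@leq_trans (\sum_(r | r \notin S) gain r)); last first.
  by apply: leq_sum => r rS; apply: pmax.
rewrite (eq_bigr (fun r => \sum_(x in U :\: unsaturated (r |: S)) 1)); last first.
  by move=> r _; rewrite sum1_card.
rewrite (exchange_big_dep (mem U)) /=; last by move=> r x _; rewrite inE => /andP[].
rewrite mulnC -sum_nat_const; apply: leq_sum => x xU.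
rewrite sum1_card; apply: leq_trans (card_saturating_points xU) _.
apply: subset_leq_card; apply/subsetP => r; rewrite in_set => /andP[rS rx].
by rewrite unfold_in /= in_setD xU rS rx.
Qed.

(** The invariant [Q], relating the size of [S] to the number of unsaturated points, is left
    abstract: it is an exponential bound for large q and a computed one for small q. The first
    alternative covers a greedy run that saturates early. *)
Lemma greedy_saturation (Q : nat -> nat -> Prop) :
  (forall u, u <= npoints -> Q 0 u) ->
  (forall k u v, k < npoints -> Q k u ->
     (npoints - k) * v + (k * q.-1 + 1) * u <= (npoints - k) * u -> Q k.+1 v) ->
  forall k, (exists2 S, saturating inc S & #|S| <= k) \/
            (exists2 S : {set P}, #|S| = k & Q k #|unsaturated S|).
Proof.
move=> Q0 QS; elim=> [|k [[S satS Sk]|[S Sk QS']]].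
- by right; exists set0; rewrite ?cards0//; apply/Q0/(leq_trans (max_card _))/card_points_le.
- by left; exists S => //; apply: leqW.
have [U0|U0] := eqVneq (unsaturated S) set0.
  by left; exists S; rewrite ?saturatingE ?U0// Sk.
have [p pS] := greedy_step U0; rewrite Sk => le.
right; exists (p |: S); first by rewrite cardsU1 pS Sk.
apply: QS le => //; rewrite -Sk; apply: leq_trans card_points_le.
rewrite -cardsT proper_card// properT; apply: contraNneq pS => ->.
by rewrite inE.
Qed.

(* For x, y unsaturated and s <> t in S, the meet of the lines xs and yt
   saturates both x and y. *)
Lemma saturate_two (S : {set P}) x y : 1 < #|S| -> x != y ->
  x \in unsaturated S -> y \in unsaturated S ->
  exists p, [disjoint [set x; y] & unsaturated (p |: S)].
Proof.
move=> /card_gt1P[s [t [sS tS st]]] xy /unsaturatedP[xS unx] /unsaturatedP[yS uny].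
have xs : x != s by apply: contraNneq xS => ->.
have yt : y != t by apply: contraNneq yS => ->.
have [l xl sl] := exists_line xs.
have [m ym tm] := exists_line yt.
(* Since neither [x] nor [y] is collinear with [s] and [t], the lines differ and their meet is
   neither [s] nor [t]. *)
have tl : ~~ inc t l by rewrite -(collinear3E t xs xl sl) unx.
have lm : l != m by apply: contraNneq tl => ->.
have [p [/andP[pl pm] _]] := pp_meet plane lm.
have ps : p != s.
  apply/eqP => ps; have /negP := uny _ _ sS tS st; apply.
  by apply/existsP; exists m; rewrite ym tm -ps pm.
have pt : p != t by apply: contraNneq tl => <-.
exists p; rewrite disjoints_subset; apply/subsetP => z; rewrite in_setC.
case/set2P => ->; first by apply: (saturated_setU1 sS ps); rewrite (collinear3E p xs xl sl).
by apply: (saturated_setU1 tS pt); rewrite (collinear3E p yt ym tm).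
Qed.

Lemma saturation_by_pairs m (S : {set P}) : 1 < #|S| -> #|unsaturated S| <= m.*2 ->
  exists2 T, saturating inc T & #|T| <= #|S| + m.
Proof.
elim: m S => [|m IH] S S1.
  rewrite leqn0 cards_eq0 => U0; exists S; rewrite ?addn0// saturatingE.
  exact: U0.
rewrite doubleS => Um.
suff [p Up] : exists p, #|unsaturated (p |: S)| <= m.*2.
  have leSp : #|S| <= #|p |: S| by rewrite subset_leq_card// subsetUr.
  have [T satT leT] := IH _ (leq_trans S1 leSp) Up.
  exists T => //; apply: leq_trans leT _.
  by rewrite addnS -addSn leq_add2r cardsU1; case: (_ \in _).
have sub p : unsaturated (p |: S) \subset unsaturated S.
  by apply/unsaturatedS/subsetUr.
have [/card_gt1P[x [y [xU yU xy]]]|U1] := ltnP 1 #|unsaturated S|.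
  have [p dis] := saturate_two S1 xy xU yU; exists p.
  have : [set x; y] \subset unsaturated S by rewrite subUset !sub1set xU.
  move=> /setIidPr xyU.
  rewrite -(cardsID [set x; y]) xyU cards2 xy add2n !ltnS in Um.
  apply: leq_trans Um; apply: subset_leq_card; apply/subsetP => z zU.
  rewrite inE (subsetP (sub p) _ zU) andbT.
  by apply/negP => zxy; have := disjointFr dis zxy; rewrite zU.
have [U0|/set0Pn[x xU]] := eqVneq (unsaturated S) set0.
  have [x _] := point_off_line; exists x.
  by rewrite (leq_trans (subset_leq_card (sub x)))// U0 cards0.
(* A single unsaturated point is itself added to [S]. *)
exists x; rewrite (leq_trans _ (leq0n _))// leqn0 cards_eq0 -subset0.
have /eqP/cards1P[z Uz] : #|unsaturated S| = 1.
  by apply/eqP; rewrite eqn_leq U1 card_gt0; apply/set0Pn; exists x.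
move: xU; rewrite Uz inE => /eqP xz.
apply/subsetP => w wU; have := subsetP (sub x) _ wU; rewrite Uz inE => /eqP wz.
by have /unsaturatedP[] := wU; rewrite wz -xz setU11.
Qed.

(** The greedy phase spends [k] points and the pairing phase [m]; pairing needs two points already
    in the set, hence [1 < k]. *)
Lemma min_saturating_le (Q : nat -> nat -> Prop) k m :
  (forall u, u <= npoints -> Q 0 u) ->
  (forall j u v, j < npoints -> Q j u ->
     (npoints - j) * v + (j * q.-1 + 1) * u <= (npoints - j) * u -> Q j.+1 v) ->
  1 < k -> (forall u, Q k u -> u <= m.*2) -> min_saturating inc <= k + m.
Proof.
move=> Q0 QS k1 Qk; have [_ minS] := min_saturatingP inc.
have [[S satS Sk]|[S Sk QkS]] := greedy_saturation Q0 QS k.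
  by rewrite (leq_trans (minS _ satS))// (leq_trans Sk) ?leq_addr.
have [|T satT leT] := @saturation_by_pairs m S _ (Qk _ QkS); first by rewrite Sk.
by rewrite (leq_trans (minS _ satT)) -?Sk.
Qed.

End Plane.

(** * Estimates for the greedy recursion *)

From mathcomp Require Import classical_sets.
Local Open Scope ring_scope.

Section Estimates.
Variable R : realType.
Implicit Types x y s t : R.

(** The function (1 - x) exp (x + x^2 / 2) has derivative - x^2 exp (x + x^2 / 2), so it never
    exceeds its value 1 at 0. *)
Lemma ler_1Bx_expR y : 0 <= y -> 1 - y <= expR (- (y + y ^+ 2 / 2)).
Proof.
move=> y0.
pose f x : R := (1 - x) * expR (x + x ^+ 2 / 2).
pose f' x : R := - x ^+ 2 * expR (x + x ^+ 2 / 2).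
have df x : is_derive x 1 f (f' x).
  rewrite /f; apply: is_derive_eq.
  by rewrite /f' /GRing.scale /=; field.
have fc : ({within `[0, y], continuous f})%classic.
  apply: continuous_subspaceT => z; apply: differentiable_continuous.
  by apply/derivable1_diffP; exact: (@ex_derive _ _ _ _ _ _ _ (df z)).
suff : f y <= f 0.
  rewrite /f subr0 mul1r expr0n /= mul0r addr0 expR0.
  by rewrite expRN -ler_pdivlMr ?expR_gt0// mul1r.
have [->//|yn0] := eqVneq y 0.
have {}y0 : 0 < y by rewrite lt_neqAle eq_sym yn0.
have [c _ e] := MVT y0 (fun x _ => df x) fc.
rewrite -subr_le0 e subr0 mulr_le0_ge0 ?(ltW y0)//.
by rewrite mulr_le0_ge0 ?expR_ge0// oppr_le0 sqr_ge0.
Qed.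

(* The exponents y + y^2 / 2 for y = j / c, summed over the naturals j < x. *)
Definition decay (c x : R) : R :=
  x * (x - 1) / (2 * c) + x * (x - 1) * (2 * x - 1) / (12 * c ^+ 2).

Lemma decayS (c x : R) : c != 0 ->
  decay c (x + 1) = decay c x + (x / c + (x / c) ^+ 2 / 2).
Proof. by move=> c0; rewrite /decay; field. Qed.

(** Allows the real number sqrt (3 q ln q) to replace the integer number of greedy steps. *)
Lemma decay_le (c x y : R) : 0 < c -> 1 <= x -> x <= y -> decay c x <= decay c y.
Proof.
move=> c0 x1 xy; rewrite /decay.
have h : x * (x - 1) <= y * (y - 1) by nra.
have h0 : 0 <= x * (x - 1) by nra.
have [c1 c2] : 0 <= (2 * c)^-1 /\ 0 <= (12 * c ^+ 2)^-1.
  by split; rewrite invr_ge0 ?mulr_ge0 ?sqr_ge0// ltW.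
apply: lerD; first exact: ler_wpM2r.
by apply: ler_wpM2r => //; apply: ler_pM => //; lra.
Qed.

(** * Exponential decay along the greedy recursion *)

Lemma decay_greedy_step (q k u v : nat) : (2 <= q)%N -> (k < (q ^ 2 + q).+1)%N ->
  (((q ^ 2 + q).+1 - k) * v + (k * q.-1 + 1) * u <= ((q ^ 2 + q).+1 - k) * u)%N ->
  u%:R <= (q ^ 2 + q).+1%:R * expR (- decay (q%:R + 2) k%:R) ->
  v%:R <= (q ^ 2 + q).+1%:R * expR (- decay (q%:R + 2) k.+1%:R) :> R.
Proof.
move=> q2 kN le ule.
have c0 : (0 : R) < q%:R + 2 by rewrite ltr_wpDl.
have vle : v%:R <= u%:R * (1 - k%:R / (q%:R + 2)) :> R.
  have -> : 1 - k%:R / (q%:R + 2) = (q%:R + 2 - k%:R) / (q%:R + 2) :> R.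
    by field; rewrite gt_eqF.
  rewrite mulrA ler_pdivlMr// mulrBr lerBrDr -!natrD -!natrM -natrD ler_nat.
  have : (((q ^ 2 + q).+1 - k) * (v * (q + 2) + u * k) <=
      ((q ^ 2 + q).+1 - k) * (u * (q + 2)))%N.
    (* The right side exceeds the left by k^2 - 3 k + q + 2, which is positive for q >= 2. *)
    have : (((q ^ 2 + q).+1 - k) * k <= (k * q.-1 + 1) * (q + 2))%N.
      case: q q2 {kN le c0 ule} => // p _ /=; nia.
    by move: le; set A := (_ - k)%N; set B := (_ + 1)%N => H1 H2; nia.
  by rewrite leq_pmul2l// subn_gt0.
have k0 : 0 <= k%:R / (q%:R + 2) :> R by rewrite divr_ge0// ltW.
rewrite -[k.+1%:R]natr1 decayS ?gt_eqF// opprD expRD mulrA.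
apply: (le_trans vle); apply: le_trans (ler_wpM2l (ler0n _ _) (ler_1Bx_expR k0)) _.
by apply: ler_wpM2r => //; exact: expR_ge0.
Qed.

(** This cubic is what the estimates [A1] to [A4] of [decay_sqrt_ge] leave after the factor 1 / s is
    taken out. The square is centred near its minimum on t >= 0. *)
Lemma cubic_ge0 t : 0 <= t ->
  0 <= 76 / 100 - t / 2 - 5 / 32 * t ^+ 2 + 156 / 1000 * t ^+ 3.
Proof.
move=> t0.
have : 0 <= (t - 14 / 10) ^+ 2 * (156 * t + 281) by rewrite mulr_ge0 ?sqr_ge0//; lra.
move=> h; nra.
Qed.

(* Applied with s = sqrt q and t = sqrt (3 ln q), so that s t = sqrt (3 q ln q). *)
Lemma decay_sqrt_ge s t : 8 <= s -> 0 <= t ->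
  t ^+ 2 / 2 + 1 / s ^+ 2 + 1 / s ^+ 4 <= 1 / (s + 1) + decay (s ^+ 2 + 2) (s * t).
Proof.
move=> s8 t0; pose c := s ^+ 2 + 2.
have s0 : 0 < s by lra.
have s20 : 0 < s ^+ 2 by rewrite exprn_gt0.
have c0 : 0 < c by rewrite /c; lra.
(* The main term t^2 / 2 is isolated by s^2 = c - 2. The rest is then compared at order 1 / s. *)
have e : decay c (s * t) = t ^+ 2 / 2 - t ^+ 2 / c - t / 2 * (s / c)
   + (s ^+ 4 / c ^+ 2) / s * (t ^+ 3 / 6 - t ^+ 2 / (4 * s) + t / (12 * s ^+ 2)).
  rewrite /decay /c; field.
  by rewrite !gt_eqF//.
rewrite -/c e.
suff : 1 / s ^+ 2 + 1 / s ^+ 4 + t ^+ 2 / c + t / 2 * (s / c) <= 1 / (s + 1) +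
  (s ^+ 4 / c ^+ 2) / s * (t ^+ 3 / 6 - t ^+ 2 / (4 * s) + t / (12 * s ^+ 2)) by lra.
have cE : c = s ^+ 2 + 2 by [].
have s64 : 64 <= s ^+ 2 by nra.
have A1 : 1 / s * (76 / 100) + 1 / s ^+ 2 + 1 / s ^+ 4 <= 1 / (s + 1).
  rewrite -subr_ge0.
  have -> : 1 / (s + 1) - (1 / s * (76 / 100) + 1 / s ^+ 2 + 1 / s ^+ 4) =
     (s ^+ 4 * (24 / 100) - (s ^+ 3 * (176 / 100) + s ^+ 2 + s + 1))
       / (s ^+ 4 * (s + 1)).
    by field; rewrite !gt_eqF//; lra.
  apply: divr_ge0; last by rewrite mulr_ge0 ?exprn_ge0//; lra.
  have : 8 * s ^+ 3 <= s ^+ 4 by rewrite (exprSr s 3) mulrC ler_pM2l ?exprn_gt0.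
  have : 8 * s ^+ 2 <= s ^+ 3 by rewrite (exprSr s 2) mulrC ler_pM2l ?exprn_gt0.
  have : 8 * s <= s ^+ 2 by rewrite expr2 ler_pM2r.
  by lra.
have A2 : t ^+ 2 / c <= 1 / s * (t ^+ 2 / 8).
  have -> : 1 / s * (t ^+ 2 / 8) = t ^+ 2 / (8 * s) by field; rewrite gt_eqF.
  rewrite ler_wpM2l ?sqr_ge0// lef_pV2 ?posrE ?mulr_gt0// cE.
  by nra.
have A3 : t / 2 * (s / c) <= 1 / s * (t / 2).
  rewrite [leRHS]mulrC ler_wpM2l ?divr_ge0// ler_pdivlMr// mulrAC ler_pdivrMr//.
  by rewrite cE; nra.
set r := s ^+ 4 / c ^+ 2.
have r1 : r <= 1.
  by rewrite ler_pdivrMr ?exprn_gt0// mul1r (exprM s 2 2) lerXn2r ?nnegrE ?cE//; lra.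
(* The worst case s^2 = 64 gives (64 / 66)^2 > 94 / 100, and a sixth of 94 / 100 exceeds the 156 /
   1000 of [B1]. *)
have r0 : 94 / 100 <= r.
  rewrite ler_pdivlMr ?exprn_gt0// (exprM s 2 2) cE.
  by move: s64; set z := s ^+ 2 => z64; nra.
have A4 : 1 / s * (156 / 1000 * t ^+ 3 - t ^+ 2 / 32) <=
    r / s * (t ^+ 3 / 6 - t ^+ 2 / (4 * s) + t / (12 * s ^+ 2)).
  have -> : r / s * (t ^+ 3 / 6 - t ^+ 2 / (4 * s) + t / (12 * s ^+ 2)) =
      1 / s * (r * (t ^+ 3 / 6) - r * (t ^+ 2 / (4 * s)) + r * (t / (12 * s ^+ 2))).
    by ring.
  rewrite ler_pM2l ?divr_gt0//.
  have t30 : 0 <= t ^+ 3 by rewrite exprn_ge0.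
  have B1 : 156 / 1000 * t ^+ 3 <= r * (t ^+ 3 / 6) by nra.
  have B2 : r * (t ^+ 2 / (4 * s)) <= t ^+ 2 / 32.
    apply: le_trans (ler_piMl _ r1) _; first by rewrite divr_ge0 ?sqr_ge0// mulr_ge0// ltW.
    by rewrite ler_wpM2l ?sqr_ge0// lef_pV2 ?posrE ?mulr_gt0//; lra.
  have B3 : 0 <= r * (t / (12 * s ^+ 2)).
    by rewrite mulr_ge0 ?divr_ge0 ?mulr_ge0//; lra.
  by lra.
have := mulr_ge0 _ (cubic_ge0 t0).
move=> /(_ (1 / s)) => /(_ ltac:(by rewrite divr_ge0// ltW)).
rewrite !mulrDr ?mulrBr; lra.
Qed.

(** Squaring exp (- 1/2) >= 1/2 gives e <= 4. *)
Lemma ln_ge1 x : 4 <= x -> 1 <= ln x.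
Proof.
move=> x4; rewrite -ler_expR lnK ?posrE; last by lra.
have := @expR_ge1Dx R (- (1 / 2)).
have e : expR (1 : R) * (expR (- (1 / 2)) * expR (- (1 / 2))) = 1.
  by rewrite -!expRD (_ : _ + _ = 0) ?expR0//; field.
have := expR_gt0 (1 : R); move: e; set e1 := expR 1; set e2 := expR _.
move=> h1 h2 h3; have h4 : 1 / 4 <= e2 * e2 by nra.
have : 0 <= e1 * (e2 * e2 - 1 / 4) by apply: mulr_ge0; [exact: ltW | rewrite subr_ge0].
by rewrite mulrBr h1; lra.
Qed.

(** With L = ln q, N = q^2 (1 + 1/q + 1/q^2) is at most exp (2 L + 1/q + 1/q^2), while s + 1 is at
    least exp (L / 2 + 1 / (s + 1)). Comparing exponents leaves [decay_sqrt_ge], where t^2 / 2 = 3 L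
    / 2. *)
Lemma greedy_decay_le (q k : nat) : (64 <= q)%N ->
  Num.sqrt (3 * q%:R * ln q%:R) <= k%:R :> R ->
  (q ^ 2 + q).+1%:R * expR (- decay (q%:R + 2) k%:R) <= Num.sqrt q%:R + 1 :> R.
Proof.
move=> q64 xk; set s : R := Num.sqrt q%:R; pose L : R := ln q%:R.
have q0 : 0 < q%:R :> R by rewrite ltr0n; lia.
have s2 : s ^+ 2 = q%:R by rewrite sqr_sqrtr// ltW.
have s8 : 8 <= s.
  by rewrite -(ler_pXn2r (n := 2))// ?nnegrE ?sqrtr_ge0// s2 -natrX ler_nat.
have L1 : 1 <= L by apply: ln_ge1; rewrite ler_nat; lia.
pose t := Num.sqrt (3 * L).
have t2 : t ^+ 2 = 3 * L by rewrite sqr_sqrtr//; lra.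
have t0 : 0 <= t by exact: sqrtr_ge0.
have xE : Num.sqrt (3 * q%:R * L) = s * t.
  by rewrite mulrAC mulrC sqrtrM// ltW.
rewrite -/L xE in xk.
have t1 : 1 <= t by nra.
have st1 : 1 <= s * t by nra.
have D : 3 / 2 * L + 1 / s ^+ 2 + 1 / s ^+ 4 - 1 / (s + 1) <= decay (q%:R + 2) k%:R.
  apply: le_trans (decay_le _ st1 xk); last by lra.
  have := decay_sqrt_ge s8 t0; rewrite t2 s2; lra.
have NE : (q ^ 2 + q).+1%:R <= expR (2 * L + 1 / s ^+ 2 + 1 / s ^+ 4).
  rewrite -addrA expRD expRM_natl lnK ?posrE//.
  apply: le_trans (ler_wpM2l (exprn_ge0 _ (ltW q0)) (expR_ge1Dx _)).
  rewrite (exprM s 2 2) s2 -natr1 natrD natrX le_eqVlt; apply/orP; left; apply/eqP.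
  by field; rewrite gt_eqF.
have sE : expR (L / 2 + 1 / (s + 1)) <= s + 1.
  have -> : L / 2 = ln s by rewrite /L -s2 lnXn ?mulr_natr//; [field | lra].
  rewrite expRD lnK ?posrE; last by lra.
  have := @expR_ge1Dx R (- (1 / (s + 1))); rewrite expRN.
  have -> : 1 - 1 / (s + 1) = s / (s + 1) by field; rewrite gt_eqF//; lra.
  rewrite ler_pdivrMr; last by lra.
  by rewrite mulrC ler_pdivlMr ?expR_gt0.
apply: le_trans sE; apply: (le_trans (ler_wpM2r (expR_ge0 _) NE)).
by rewrite -expRD ler_expR; lra.
Qed.

(* A lower bound for 1000 ln ((i + 2) / 2): each j = 3, ..., i + 2 contributes
   ln (j / (j - 1)) >= 1/j + 1/(2 j^2), scaled and rounded down.  Starting from 2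
   instead of 1 makes the bound for ln q = ln (2q / 2) sharp enough at q = 2. *)
Fixpoint log_sum (i : nat) : N :=
  if i is i'.+1 then
    let j := (N.of_nat i' + 3)%num in
    (log_sum i' + 1000 * (2 * j + 1) / (2 * j * j))%num
  else 0%num.

Lemma N_to_nat_div_le (a b : N) : b <> 0%num ->
  (N.to_nat (a / b)%num)%:R <= (N.to_nat a)%:R / (N.to_nat b)%:R :> R.
Proof.
move=> b0; rewrite ler_pdivlMr ?ltr0n; last by lia.
rewrite -natrM ler_nat; have := N.Div0.mul_div_le a b; lia.
Qed.

Lemma log_sum_le i : (N.to_nat (log_sum i))%:R <= 1000 * (ln (i + 2)%:R - ln 2) :> R.
Proof.
elim: i => [|i IH]; first by rewrite /= add0n subrr mulr0.
have step : (2 * (i + 3)%:R + 1) / (2 * (i + 3)%:R * (i + 3)%:R)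
    <= ln (i + 3)%:R - ln (i + 2)%:R :> R.
  have i0 : 0 < (i + 3)%:R :> R by rewrite ltr0n addn3.
  rewrite -ler_expR expRB !lnK ?posrE ?ltr0n ?addn2 ?addn3//.
  (* At y = 1 / j the second-order bound reads (j - 1) / j <= exp (- (1/j + 1/(2 j^2))). *)
  have := @ler_1Bx_expR (1 / (i + 3)%:R) (divr_ge0 ler01 (ltW i0)).
  rewrite addn3 in i0 *; rewrite expRN -[i.+2%:R](addrK 1) natr1.
  set z := i.+3%:R in i0 *.
  have z1 : 0 < z - 1 by rewrite /z subr_gt0 ltr1n.
  clearbody z; have -> : 1 - 1 / z = (z - 1) / z by field; rewrite gt_eqF.
  have -> : 1 / z + (1 / z) ^+ 2 / 2 = (2 * z + 1) / (2 * z * z).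
    by field; rewrite gt_eqF.
  set e := expR _ => h; have e0 : 0 < e by exact: expR_gt0.
  by rewrite -[e]invrK -[z / _]invf_div lef_pV2 ?posrE ?invr_gt0 ?divr_gt0.
rewrite (_ : i.+1 + 2 = i + 3)%N; last by lia.
have := @N_to_nat_div_le (1000 * (2 * (N.of_nat i + 3) + 1))
  (2 * (N.of_nat i + 3) * (N.of_nat i + 3)) ltac:(lia).
move=> h; rewrite [log_sum _]/= N2Nat.inj_add plusE [X in X <= _]natrD; move: h.
set j := (N.of_nat i + 3)%num; set w := (_ / _)%num.
have jE : N.to_nat j = (i + 3)%N by rewrite /j; lia.
have -> : N.to_nat (1000 * (2 * j + 1)) = (1000 * (2 * (i + 3) + 1))%N by lia.
have -> : N.to_nat (2 * j * j) = (2 * (i + 3) * (i + 3))%N by rewrite !N2Nat.inj_mul jE; lia.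
rewrite !natrM (natrD _ (2 * (i + 3))) natrM -(mulrA 1000) => h.
by move: IH step h; lra.
Qed.

(** * Evaluating the recursion for small orders *)

Fixpoint greedy_bound (q : N) (k : nat) : N :=
  if k is j.+1 then
    let d := (q * q + q + 1 - N.of_nat j)%num in
    (greedy_bound q j * (d - (N.of_nat j * (q - 1) + 1)) / d)%num
  else (q * q + q + 1)%num.

(** Rounding down is sound because the number of unsaturated points is an integer. *)
Lemma greedy_bound_step (q k u v : nat) : (0 < q)%N -> (k < (q ^ 2 + q).+1)%N ->
  (((q ^ 2 + q).+1 - k) * v + (k * q.-1 + 1) * u <= ((q ^ 2 + q).+1 - k) * u)%N ->
  (N.of_nat u <= greedy_bound (N.of_nat q) k)%num ->
  (N.of_nat v <= greedy_bound (N.of_nat q) k.+1)%num.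
Proof.
move=> q0 kN le ule /=; set g := greedy_bound _ _ in ule *.
set d := (_ - N.of_nat k)%num; set a := (_ * _ + 1)%num.
have dE : d = N.of_nat ((q ^ 2 + q).+1 - k) by rewrite /d -mulnn; lia.
have aE : a = N.of_nat (k * q.-1 + 1) by rewrite /a; nia.
have d0 : (0 < (q ^ 2 + q).+1 - k)%N by rewrite subn_gt0.
rewrite dE aE; move: (_ - k)%N (_ + 1)%N le d0 => D A le D0.
apply: N.div_le_lower_bound; first by lia.
(* If [D < A], the truncated difference is 0, but then [le] forces [u] and [v] to vanish. *)
case: (leqP A D) => AD; nia.
Qed.

(** The last two tests certify a bound of at most sqrt q + 1 after [k] steps, and k - 1 < sqrt (3 q
    ln q). The index 2 q - 2 makes [log_sum] a lower bound for 1000 ln q. *)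
Definition small_order_ok (q k : nat) : bool :=
  let n := N.of_nat q in let m := N.of_nat k.-1 in
  let g := (greedy_bound n k - 1)%num in
  [&& 1 < k, N.leb (g * g) n & N.ltb (1000 * (m * m)) (3 * n * log_sum (2 * q - 2))]%N.

Lemma small_orders : all (fun q => has (small_order_ok q) (iota 2 27)) (iota 2 62).
Proof. by vm_compute. Qed.

Lemma le_ceil_nat (k : nat) x : k.-1%:R < x -> k%:Z <= Num.ceil x.
Proof.
case: k => [|k] /= kx; first by rewrite ceil_ge0; lra.
by rewrite intS addrC lezD1 ceil_gt_int.
Qed.

(** The common end of both ranges of q: k - 1 < x yields k <= ceil x, and twice the second ceiling
    is at least sqrt q + 1. *)
Lemma min_saturating_le_ceil (P L : finType) (inc : P -> L -> bool) (q k : nat)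
    (Q : nat -> nat -> Prop) :
  projective_plane inc q ->
  (forall u, (u <= (q ^ 2 + q).+1)%N -> Q 0%N u) ->
  (forall j u v, (j < (q ^ 2 + q).+1)%N -> Q j u ->
     (((q ^ 2 + q).+1 - j) * v + (j * q.-1 + 1) * u <= ((q ^ 2 + q).+1 - j) * u)%N ->
     Q j.+1 v) ->
  (1 < k)%N -> k.-1%:R < Num.sqrt (3 * q%:R * ln q%:R) :> R ->
  (forall u, Q k u -> u%:R <= Num.sqrt q%:R + 1 :> R) ->
  (min_saturating inc)%:Z <= Num.ceil (Num.sqrt (3 * q%:R * ln (q%:R : R)))
    + Num.ceil ((Num.sqrt (q%:R : R) + 1) / 2).
Proof.
move=> plane Q0 QS k1 kx Qk.
set y : R := _ / 2; have y0 : 0 <= y by rewrite divr_ge0 ?addr_ge0 ?sqrtr_ge0.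
have c0 : 0 <= Num.ceil y by rewrite ceil_ge0; lra.
have := @min_saturating_le P L inc q plane Q k `|Num.ceil y|%N Q0 QS k1.
have mE : (`|Num.ceil y|%N)%:Z = Num.ceil y by rewrite gez0_abs.
have H u : Q k u -> (u <= `|Num.ceil y|.*2)%N.
  move=> /Qk uy; rewrite -(ler_nat R) -muln2 natrM.
  have := ceil_ge y; rewrite -{1}mE -pmulrn /y; lra.
move=> /(_ H) le; rewrite -mE.
apply: (@le_trans _ _ (k + `|Num.ceil y|)%N%:Z) => //.
by rewrite PoszD lerD2r le_ceil_nat.
Qed.
End Estimates.

(** * The bound for every order *)

Theorem mainTheorem2 (R : realType) (P L : finType) (inc : P -> L -> bool)
    (q : nat) (hq : (2 <= q)%N) (hplane : projective_plane inc q) :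
  (min_saturating inc)%:Z <=
    Num.ceil (Num.sqrt (3 * q%:R * ln (q%:R : R)))
    + Num.ceil ((Num.sqrt (q%:R : R) + 1) / 2).
Proof.
have q0 : 0 < q%:R :> R by rewrite ltr0n; lia.
have [q64|q64] := ltnP q 64.
  have /allP/(_ q) := small_orders; rewrite mem_iota hq q64 => /(_ isT)/hasP[k _].
  case/and3P => k1 /N.leb_le g_le /N.ltb_lt lt.
  apply: (@min_saturating_le_ceil R P L inc q k
    (fun j u => N.of_nat u <= greedy_bound (N.of_nat q) j)%num) => //.
  - by move=> u /=; rewrite -mulnn; lia.
  - by move=> j u v jN ule le; apply: greedy_bound_step le ule => //; lia.
  - rewrite -[ltLHS]ger0_norm// -sqrtr_sqr ltr_sqrt; last first.
      by rewrite !mulr_gt0// ln_gt0// ltr1n.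
    have := @log_sum_le R (2 * q - 2).
    rewrite (_ : 2 * q - 2 + 2 = 2 * q)%N; last by lia.
    rewrite natrM lnM ?posrE// addrAC subrr add0r => h.
    have : (1000 * (k.-1 * k.-1) < 3 * q * N.to_nat (log_sum (2 * q - 2)))%N by lia.
    rewrite -(ltr_nat R) !natrM => h2; rewrite -(@ltr_pM2l _ 1000)// expr2.
    apply: (lt_le_trans h2); rewrite mulrCA; apply: ler_wpM2l => //.
    by rewrite mulr_ge0// ltW.
  (* The predecessor matches the [- 1] in [small_order_ok]; truncation at u = 0 is harmless as sqrt
     q + 1 is positive. *)
  move=> u ule; have uq : (u.-1 * u.-1 <= q)%N.
    by move: g_le; set g := greedy_bound _ _ in ule *; nia.
  have : u.-1%:R <= Num.sqrt q%:R :> R.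
    rewrite -[leLHS]ger0_norm// -sqrtr_sqr ler_sqrt; last exact: ltW.
    by rewrite expr2 -natrM ler_nat.
  by case: u {ule uq} => [|u] /=; rewrite -?natr1; have := sqrtr_ge0 (q%:R : R); lra.
set x : R := Num.sqrt _.
(* Makes the ceiling at least 2, as the pairing phase requires. *)
have x1 : 1 < x.
  have L1 : 1 <= ln q%:R :> R by apply: ln_ge1; rewrite ler_nat; lia.
  have q1 : 1 <= q%:R :> R by rewrite ler1n; lia.
  by rewrite -sqrtr1 ltr_sqrt; nra.
have x0 : 0 <= Num.ceil x by rewrite ceil_ge0; lra.
have kE : (`|Num.ceil x|%N)%:Z = Num.ceil x by rewrite gez0_abs.
apply: (@min_saturating_le_ceil R P L inc q `|Num.ceil x|%N (fun j u =>
  u%:R <= (q ^ 2 + q).+1%:R * expR (- decay (q%:R + 2) j%:R) :> R)) => //.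
- by move=> u uN; rewrite /decay !mul0r addr0 oppr0 expR0 mulr1 ler_nat.
- by move=> j u v jN ule le; apply: decay_greedy_step le ule.
- by rewrite -ltz_nat kE ceil_gt_int.
- have : (0 < `|Num.ceil x|)%N by rewrite -ltz_nat kE ceil_gt_int; lra.
  have := ceilB1_lt x; rewrite -kE.
  by case: `|_|%N => // k; rewrite intS addrC addKr -pmulrn.
move=> u ule; apply: (le_trans ule); apply: greedy_decay_le => //.
by rewrite [leRHS]pmulrn kE ceil_ge.
Qed.
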